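(* Let $n\ge 2$, let $G=(V,E)$ be a complete graph on $n$ vertices with distinct positive edge weights, and let $k\in\{1,2,\dots,n-1\}$. Define \[ M_k(G)=\bigcup_{X\subseteq V,\ |X|=k-1}\mathrm{MST}(G[V\setminus X]). \] Then $|M_k(G)|\le nk-\binom{k+1}{2}$.
   Context: For $X\subseteq V$, $G[V\setminus X]$ denotes the subgraph of $G$ induced by $V\setminus X$, with the inherited edge weights. $\mathrm{MST}(H)$ denotes the set of edges of the minimum-weight spanning tree of a connected weighted graph $H$; it is unique because the edge weights are distinct. *)

(* Defs.v *)
From HB Require Import structures.
From mathcomp Require Import all_boot all_order all_algebra.
From mathcomp Require Import boolp.
Set Implicit Arguments. Unset Strict Implicit. Unset Printing Implicit Defensive.
Import Order.TTheory GRing.Theory Num.Theory.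
Local Open Scope ring_scope.

Section MST.
Variables (R : realFieldType) (V : finType).

Definition is_edge (e : {set V}) : bool := #|e| == 2%N.

Definition cedges (S : {set V}) : {set {set V}} :=
  [set e : {set V} | is_edge e && (e \subset S)].

Definition adj (T : {set {set V}}) : rel V := fun x y => (x != y) && ([set x; y] \in T).

Definition connected_on (S : {set V}) (T : {set {set V}}) : bool :=
  [forall x in S, forall y in S, connect (adj T) x y].

Definition acyclic (T : {set {set V}}) : Prop :=
  forall c : seq V, uniq c -> (2 < size c)%N -> ~~ cycle (adj T) c.

Definition spanning_tree (S : {set V}) (T : {set {set V}}) : Prop :=
  T \subset cedges S /\ connected_on S T /\ acyclic T.

Definition weight (w : {set V} -> R) (T : {set {set V}}) : R := \sum_(e in T) w e.

Definition is_mst (w : {set V} -> R) (S : {set V}) (T : {set {set V}}) : Prop :=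
  spanning_tree S T /\
  forall T', spanning_tree S T' -> weight w T <= weight w T'.

(* MST(G[S]): the (unique, under distinct weights) minimum spanning tree *)
Definition MST (w : {set V} -> R) (S : {set V}) : {set {set V}} :=
  odflt set0 [pick T : {set {set V}} | `[< is_mst w S T >] ].

Definition Mk (w : {set V} -> R) (k : nat) : {set {set V}} :=
  \bigcup_(X : {set V} | #|X| == k.-1) MST w (~: X).

End MST.

(* Main.v *)
(** The edges of M_k(G) are independent in Kalai's k-dimensional
    hyperconnectivity matroid, whose rank on n >= k points is
    nk - binom(k+1, 2).  Give the vertices distinct scalars t_x, and call a
    motion a family of polynomials m_x of degree < k, so that motions form a
    space of dimension nk; the edge xy tests the equation m_x(t_y) = m_y(t_x).
    If e is in MST(G - X) with |X| = k - 1, deleting e from the tree splits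
    G - X into two sides C and D, and every edge between C and D is at least
    as heavy as e.  With q the product of the (T - t_x) for x in X, the motion
    m_x = q(t_x) q on C and 0 elsewhere satisfies the equation of each edge
    lighter than e, but not that of e.  By this triangularity the motions of
    the edges of M_k(G) are independent, even modulo the
    binom(k+1, 2)-dimensional space of motions coming from symmetric
    polynomials in two variables, which satisfy the equation of every edge. *)

Require Import Defs.
From HB Require Import structures.
From mathcomp Require Import all_boot all_order all_algebra.
From mathcomp Require Import boolp.
Set Implicit Arguments. Unset Strict Implicit. Unset Printing Implicit Defensive.
Import Order.TTheory GRing.Theory Num.Theory.
Local Open Scope ring_scope.

(** * Paths, bridges and exchange in spanning trees *)

Lemma adj_sym (V : finType) (T : {set {set V}}) : symmetric (adj T).
Proof. by move=> x y; rewrite /adj eq_sym setUC. Qed.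

Lemma connect_adj_sym (V : finType) (T : {set {set V}}) :
  connect_sym (adj T).
Proof. exact/sym_connect_sym/adj_sym. Qed.

Lemma adj_sub (V : finType) (T T' : {set {set V}}) :
  T \subset T' -> subrel (adj T) (adj T').
Proof. by move=> /subsetP sTT' x y /andP[xy /sTT' T'xy]; apply/andP. Qed.

Lemma adjD1 (V : finType) (T : {set {set V}}) (e : {set V}) (x y : V) :
  adj T x y -> [set x; y] != e -> adj (T :\ e) x y.
Proof. by move=> /andP[xy Txy] ne; rewrite /adj xy in_setD1 ne. Qed.

(** A simple path from [u] to [v] avoiding the edge [uv] has an inner vertex, so closing it with
    that edge would give a cycle of length at least 3. *)
Lemma acyclic_bridge (V : finType) (T : {set {set V}}) (u v : V) :
  acyclic T -> u != v -> [set u; v] \in T ->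
  ~~ connect (adj (T :\ [set u; v])) u v.
Proof.
move=> acT uv Tuv; apply/negP => /connectP[p0 p0P v_last].
case: (shortenP p0P) v_last => p pP up _ v_last.
case: p pP up v_last => [_ _ /= vu|y [|z s] pP up v_last].
- by rewrite vu eqxx in uv.
- by move: pP; rewrite /= -[y]v_last andbT /adj !inE eqxx andbF.
have /negP[] := acT [:: u, y, z & s] up isT.
rewrite (cycle_path u) /=; apply/andP; split.
  by rewrite -[last z s]v_last adj_sym /adj uv.
by apply: sub_path pP; apply/adj_sub/subsetDl.
Qed.

Lemma acyclic_add (V : finType) (T : {set {set V}}) (x y : V) :
  acyclic T -> ~~ connect (adj T) x y -> acyclic ([set x; y] |: T).
Proof.
move=> acT nxy c uc sc; apply/negP => cyc.
have adjE a b : adj ([set x; y] |: T) a b -> [set a; b] != [set x; y] ->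
    adj T a b.
  by move=> /andP[ab]; rewrite in_setU1 /adj ab => /orP[->|].
have /negP[] := acT c uc sc.
apply: cycle_from_next => // z zc; apply: (adjE); first exact: next_cycle.
apply/negP => /eqP zxy; move/negP: nxy; apply.
have [i s rs] := rot_to zc.
move: zxy; rewrite -(next_rot i) // rs.
have ur : uniq (z :: s) by rewrite -rs rot_uniq.
have cr : cycle (adj ([set x; y] |: T)) (z :: s) by rewrite -rs rot_cycle.
have : (2 < size (z :: s))%N by rewrite -rs size_rot.
(* The only edge that may be missing from T joins z to its successor z2, so
   the rest of the cycle connects z2 back to z in T. *)
case: s ur cr {rs} => [|z2 [|z3 s]] // ur.
rewrite [next _ _]/= eqxx => cr _ zxy.
suff zz2 : connect (adj T) z2 z.
  have xyzz : (x \in [set z; z2]) && (y \in [set z; z2]).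
    by rewrite zxy !inE !eqxx orbT.
  move: xyzz; rewrite !inE => /andP[/orP[]/eqP-> /orP[]/eqP->] //.
  by rewrite connect_adj_sym.
move: ur; rewrite cons_uniq => /andP[zs].
move: cr; rewrite /cycle rcons_path => /andP[/=/andP[_ pth] lst].
move=> ur2.
have lastne : last z3 s != z2.
  apply/negP => /eqP lz; move: ur2 => /= /andP[]; rewrite -lz.
  by rewrite (mem_last z3 s).
apply: (@connect_trans _ _ (last z3 s)).
  apply/connectP; exists (z3 :: s) => //.
  have adjT : {in [in [:: z2, z3 & s]] &,
      subrel (adj ([set x; y] |: T)) (adj T)}.
    move=> a b az bz Tab; apply: (adjE) => //; rewrite -zxy.
    apply/negP => /eqP abz.
    have : z \in [set a; b] by rewrite abz !inE eqxx.
    by rewrite !inE => /orP[]/eqP za; move: zs; rewrite za; [move: az|move: bz] => /= ->.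
  have alls : all [in [:: z2, z3 & s]] (z2 :: z3 :: s) by apply/allP.
  exact (sub_in_path adjT alls pth).
apply: connect1; apply: (adjE) => //; rewrite -zxy.
apply/negP => /eqP lz.
have : z2 \in [set last z3 s; z] by rewrite lz !inE eqxx orbT.
rewrite !inE eq_sym (negPf lastne) /= => /eqP z2z.
by move: zs; rewrite -z2z !inE eqxx.
Qed.

(** Induction on the walk from [u]: whenever it traverses the removed edge, it restarts at [u] or at
    [v]. *)
Lemma connect_bridge (V : finType) (T : {set {set V}}) (u v z : V) :
  connect (adj T) u z ->
  connect (adj (T :\ [set u; v])) u z || connect (adj (T :\ [set u; v])) v z.
Proof.
case/connectP => p; elim/last_ind: p z => [z _ -> /=|p a IH z].
  by rewrite connect0.
rewrite rcons_path last_rcons => /andP[pp la] ->.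
have := IH _ pp erefl; set b := last u p in la *.
have [bae _|ne] := eqVneq [set b; a] [set u; v].
  have : a \in [set u; v] by rewrite -bae !inE eqxx orbT.
  by rewrite !inE => /orP[]/eqP->; rewrite connect0 ?orbT.
by case/orP=> cb; apply/orP; [left|right]; apply: (connect_trans cb);
  apply/connect1/adjD1.
Qed.

(** [C] is the component of [u] in [T] without [e]. Exchanging [e] for any edge [f] across the cut
    gives another spanning tree, and minimality of [T] compares the two weights. *)
Lemma mst_cut (R : realFieldType) (V : finType) (w : {set V} -> R)
    (S : {set V}) (T : {set {set V}}) (e : {set V}) :
  is_mst w S T -> e \in T ->
  exists (C : {set V}) (u v : V),
    [/\ e = [set u; v], u \in C, v \in S :\: C, C \subset S &
        forall x y, x \in C -> y \in S :\: C -> w e <= w [set x; y]].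
Proof.
move=> [[sT [conT acT]] minT] eT.
have /subsetP/(_ _ eT) := sT; rewrite inE => /andP[/cards2P[u [v [uv e_uv]]] eS].
have [uS vS] : u \in S /\ v \in S.
  by split; apply: (subsetP eS); rewrite e_uv !inE eqxx ?orbT.
pose T0 := T :\ e.
have nuv : ~~ connect (adj T0) u v.
  by rewrite /T0 e_uv; apply: acyclic_bridge => //; rewrite -e_uv.
exists [set x in S | connect (adj T0) u x], u, v.
split=> //; rewrite ?inE ?uS ?vS ?connect0 //=.
- by rewrite nuv.
- by apply/subsetP => x; rewrite inE => /andP[].
move=> x y; rewrite !inE => /andP[xS ux] /andP[+ yS]; rewrite yS /= => uy.
set f := [set x; y].
have conTS z z' : z \in S -> z' \in S -> connect (adj T) z z'.
  by move=> zS z'S; have /forall_inP/(_ z zS)/forall_inP/(_ z' z'S) := conT.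
have nxy : ~~ connect (adj T0) x y.
  by apply: contra uy; apply: connect_trans.
have xy : x != y by apply: contraNneq nxy => ->; rewrite connect0.
have vy : connect (adj T0) v y.
  have := @connect_bridge V T u v y (conTS _ _ uS yS).
  by rewrite -e_uv -/T0 (negPf uy).
have fT0 : f \notin T0.
  by apply: contra nxy => fT; apply/connect1; rewrite /adj xy.
have acT0 : acyclic T0.
  move=> c uc sc; apply: contra (acT c uc sc).
  by apply: sub_cycle; apply/adj_sub/subsetDl.
have subT' : subrel (connect (adj T0)) (connect (adj (f |: T0))).
  apply: connect_sub => a b ab; apply/connect1.
  by apply: adj_sub ab; apply: subsetUr.
have uv' : connect (adj (f |: T0)) u v.
  apply: (@connect_trans _ _ x); first exact: subT'.
  apply: (@connect_trans _ _ y); last first.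
    by rewrite connect_adj_sym; apply: subT'.
  by apply: connect1; rewrite /adj xy setU11.
have uz' z : z \in S -> connect (adj (f |: T0)) u z.
  move=> zS; have := @connect_bridge V T u v z (conTS _ _ uS zS).
  rewrite -e_uv -/T0 => /orP[]; first exact: subT'.
  by move/subT'; apply: connect_trans.
have st' : spanning_tree S (f |: T0).
  split; last split; last exact: acyclic_add.
    apply/subsetP => g; rewrite !inE => /orP[/eqP->|/andP[_ gT]].
      rewrite /is_edge cards2 xy eqxx /=; apply/subsetP => z.
      by rewrite !inE => /orP[]/eqP->.
    by have := subsetP sT g gT; rewrite inE.
  apply/forall_inP => z zS; apply/forall_inP => z' z'S.
  by apply: connect_trans (uz' z' z'S); rewrite connect_adj_sym uz'.
have := minT _ st'.
rewrite /weight (big_setD1 e) //= big_setU1 //=.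
by rewrite lerD2r.
Qed.

(** * Linear independence and counting of index pairs *)

Lemma independent_card (F : fieldType) (I J : finType) (g : I -> J -> F) :
  (forall c : I -> F, (forall j, \sum_i c i * g i j = 0) -> forall i, c i = 0) ->
  (#|I| <= #|J|)%N.
Proof.
move=> gfree.
pose A : 'M[F]_(#|I|, #|J|) := \matrix_(i, j) g (enum_val i) (enum_val j).
suff /eqP <- : row_free A by exact: rank_leq_col.
apply: inj_row_free => v vA0; apply/rowP => i; rewrite mxE -[i]enum_valK.
apply: (gfree (fun i => v 0 (enum_rank i))) => j.
have := congr1 (fun u : 'rV_#|J| => u 0 (enum_rank j)) vA0.
rewrite !mxE => vA0j; rewrite -[RHS]vA0j.
rewrite (reindex (@enum_val I I)) /=; last exact/onW_bij/enum_val_bij.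
by apply: eq_bigr => a _; rewrite mxE enum_rankK enum_valK.
Qed.

Lemma card_pairs_leq (k : nat) :
  #|{: {p : 'I_k * 'I_k | (p.2 <= p.1)%N}}| = 'C(k.+1, 2).
Proof.
rewrite card_sig -sum1_card.
rewrite -(pair_big_dep xpredT (fun i j : 'I_k => (j <= i)%N) (fun _ _ => 1%N)) /=.
rewrite -bin2_sum big_nat_recl // add0n big_mkord; apply: eq_bigr => i _.
have := @big_ord_widen_cond _ 0%N addn i.+1 k xpredT (fun=> 1%N) (ltn_ord i).
by rewrite sum1_card card_ord => ->.
Qed.

(** * Motions attached to the edges of [Mk] *)

Definition separating_motion (R : realFieldType) (V : finType)
    (w : {set V} -> R) (k : nat) (t : V -> R) (e : {set V})
    (m : V -> {poly R}) : Prop :=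
  [/\ forall x, (size (m x) <= k)%N,
      forall x y, x != y -> w [set x; y] < w e -> (m x).[t y] = (m y).[t x] &
      exists u v, [/\ u != v, e = [set u; v] & (m u).[t v] != (m v).[t u]]].

Lemma Mk_separating_motion (R : realFieldType) (V : finType)
    (w : {set V} -> R) (k : nat) (t : V -> R) (e : {set V}) :
  injective t -> (0 < k)%N -> e \in Mk w k ->
  exists m, separating_motion w k t e m.
Proof.
move=> t_inj k0 /bigcupP[X /eqP cX]; rewrite /MST.
(* The default value of [MST] is empty, so having [e] as an element provides a genuine minimum
   spanning tree. *)
case: pickP => [T /asboolP mstT|_] /=; last by rewrite inE.
move=> /(mst_cut mstT)[C [u [v [eE uC vC sC minC]]]].
pose q : {poly R} := \prod_(x in X) ('X - (t x)%:P).
have q0 x : (q.[t x] == 0) = (x \in X).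
  rewrite /q horner_prod; apply/prodf_eq0/idP => [[y yX]|xX].
    by rewrite !hornerE subr_eq0 => /eqP/t_inj ->.
  by exists x; rewrite // !hornerE subrr.
have sq : (size q <= k)%N.
  by rewrite /q -big_enum /= size_prod_XsubC -cardE cX prednK.
have CX x : x \in C -> q.[t x] != 0.
  by move=> /(subsetP sC); rewrite q0 inE.
exists (fun x => if x \in C then q.[t x] *: q else 0); split.
- by move=> x; case: ifP => _; rewrite ?size_poly0 // (leq_trans (size_scale_leq _ _)).
(* An edge leaving [C] that is lighter than [e] cannot cross the cut, so it ends in [X], where [q]
   vanishes. *)
- have out x y : x \in C -> y \notin C -> w [set x; y] < w e -> q.[t y] = 0.
    move=> xC yC; rewrite ltNge => lt_e; apply/eqP; rewrite q0.
    apply: contraR lt_e => yX; apply: minC => //.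
    by rewrite !inE yC yX.
  move=> x y _ lt_e; case: ifPn => xC; case: ifPn => yC; rewrite !hornerE //.
  + exact: mulrC.
  + by rewrite (out x y) ?mulr0.
  + by rewrite (out y x) ?mulr0 // setUC.
- exists u, v; move: vC; rewrite !inE => /andP[vC vX]; split=> //.
    by apply: contraNneq vC => <-.
  by rewrite uC (negPf vC) hornerZ horner0 mulf_neq0 ?(CX u) ?q0.
Qed.

Lemma separating_motion_card (R : realFieldType) (V : finType)
    (w : {set V} -> R) (k : nat) (t : V -> R) (M : {set {set V}}) :
  injective t -> (k <= #|V|)%N -> {in M &, injective w} ->
  (forall e, e \in M -> exists m, separating_motion w k t e m) ->
  (#|M| + 'C(k.+1, 2) <= #|V| * k)%N.
Proof.
move=> t_inj kV w_inj sepM.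
pose I : finType := {e : {set V} | e \in M}.
pose J : finType := {p : 'I_k * 'I_k | (p.2 <= p.1)%N}.
have [m mP] := choice (fun e : I => sepM _ (valP e)).
(* The symmetric polynomial S^i T^j + S^j T^i evaluated at S = t x. *)
pose s (p : 'I_k * 'I_k) x : {poly R} :=
  t x ^+ p.1 *: 'X^(p.2) + t x ^+ p.2 *: 'X^(p.1).
(* Each motion is recorded by its coefficients: one coordinate per vertex and degree below [k]. *)
pose g (i : I + J) (j : V * 'I_k) : R :=
  match i with inl e => m e j.1 | inr p => s (val p) j.1 end`_j.2.
rewrite -card_pairs_leq -/J -[k in leqRHS]card_ord -card_prod.
have -> : #|M| = #|I| by rewrite card_sig.
rewrite -card_sum; apply: (@independent_card _ _ _ g) => c c0.
have ssize p x : (size (s p x) <= k)%N.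
  rewrite (leq_trans (size_polyD _ _)) // geq_max.
  by rewrite !(leq_trans (size_scale_leq _ _)) // size_polyXn.
have sum0 x :
    \sum_e c (inl e) *: m e x + \sum_p c (inr p) *: s (val p) x = 0.
  apply/polyP => l; rewrite coef0 coefD !coef_sum.
  have [lk|kl] := ltnP l k.
    have c0x := c0 (x, Ordinal lk); rewrite -[RHS]c0x big_sumType /=.
    by congr (_ + _); apply: eq_bigr => i _; rewrite coefZ.
  rewrite !big1 ?addr0 // => i _; rewrite coefZ nth_default ?mulr0 //.
    exact: leq_trans kl.
  by case: (mP i) => sm _ _; apply: leq_trans kl.
have ssym p x y : (s p x).[t y] = (s p y).[t x].
  by rewrite !hornerE addrC mulrC [X in _ + X]mulrC.
have cl0 e : c (inl e) = 0.
  apply/eqP/negPn/negP => ce0.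
  (* Test the equation of a lightest edge [e1] with nonzero coefficient. The other edges that still
     contribute are strictly heavier, so their motions satisfy it, as do the symmetric ones. *)
  have [e1 {}ce0 e1min] :
      exists2 e1, c (inl e1) != 0 & forall e, c (inl e) != 0 -> w (val e1) <= w (val e).
    by case: (arg_minP (P := fun e => c (inl e) != 0) (fun e : I => w (val e)) ce0)
      => e1 ? ?; exists e1.
  have [_ _ [u [v [uv e1E muv]]]] := mP e1.
  move/eqP: ce0; apply; apply/eqP.
  have : \sum_e (c (inl e) *: m e u).[t v] = \sum_e (c (inl e) *: m e v).[t u].
    apply: (addIr (\sum_p (c (inr p) *: s (val p) u).[t v])).
    under [X in _ = _ + X]eq_bigr do rewrite hornerZ ssym -hornerZ.
    by rewrite -!horner_sum -!hornerD !sum0 !horner0.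
  move/eqP; rewrite -subr_eq0 -sumrB (bigD1 e1) //= big1 ?addr0.
    by rewrite !hornerZ -mulrBr mulf_eq0 subr_eq0 (negPf muv) orbF.
  move=> f fe1; rewrite !hornerZ -mulrBr.
  have [->|cf0] := eqVneq (c (inl f)) 0; first by rewrite mul0r.
  have [_ mf _] := mP f; rewrite mf ?subrr ?mulr0 // -e1E lt_neqAle e1min //.
  rewrite andbT; apply: contraNneq fe1 => wE; apply/eqP/val_inj.
  by apply: w_inj; rewrite ?(valP f) ?(valP e1).
have cr0 p : c (inr p) = 0.
  (* [r] is the coefficient of T^b in the sum of the symmetric motions, as a
     polynomial in S: it has the #|V| >= k roots t x. *)
  case: p => [[a b] /= le_ba]; set p0 := exist _ _ _.
  pose r : {poly R} := \sum_p c (inr p) *: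
    (((val p).2 == b)%:R *: 'X^((val p).1) + ((val p).1 == b)%:R *: 'X^((val p).2)).
  have r0 : r = 0.
    apply: (@roots_geq_poly_eq0 _ _ [seq t x | x <- enum V]).
    - apply/allP => _ /mapP[x _ ->]; apply/rootP.
      have := congr1 (fun p : {poly R} => p`_b) (sum0 x).
      rewrite big1 => [|e _]; last by rewrite cl0 scale0r.
      rewrite add0r coef0 coef_sum horner_sum => sum0b; rewrite -[RHS]sum0b.
      apply: eq_bigr => p _.
      rewrite hornerZ hornerD !hornerZ !hornerXn coefZ coefD !coefZ !coefXn.
      by rewrite ![b == _ :> nat]eq_sym mulrC ![_%:R * _]mulrC [RHS]mulrC.
    - by rewrite map_inj_uniq ?enum_uniq.
    rewrite size_map -cardE (leq_trans _ kV) //.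
    apply: (leq_trans (size_sum _ _ _)); apply/bigmax_leqP => p _.
    rewrite (leq_trans (size_scale_leq _ _)) // (leq_trans (size_polyD _ _)) //.
    by rewrite geq_max !(leq_trans (size_scale_leq _ _)) // size_polyXn.
  have := congr1 (fun p : {poly R} => p`_a) r0.
  rewrite /= coef0 coef_sum (bigD1 p0) //= big1 => [|[[a' b'] /= le_ba'] ne].
    (* The coefficient contributed by [p0] is 1, or 2 when [a = b]; it is nonzero in characteristic
       0. *)
    rewrite addr0 coefZ coefD !coefZ !coefXn !eqxx mulr1 => /eqP.
    by rewrite mulf_eq0 -natrM -natrD pnatr_eq0 orbF => /eqP.
  rewrite coefZ coefD !coefZ !coefXn -!natrM -natrD.
  rewrite (_ : (_ + _)%N = 0%N) ?mulr0 //.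
  apply/eqP; rewrite addn_eq0 !muln_eq0 !eqb0 -!negb_and.
  apply/andP; split; apply: contra ne => /andP[/eqP eb /eqP/val_inj ea].
    by rewrite -val_eqE /= xpair_eqE -ea eb !eqxx.
  (* The swapped pair [(b, a)] is an index only when [a <= b], which forces [a = b]. *)
  rewrite -val_eqE /= xpair_eqE eb -ea; rewrite eb -ea in le_ba'.
  have -> : a = b by apply/val_inj/eqP; rewrite eqn_leq le_ba le_ba'.
  by rewrite eqxx.
by case.
Qed.

Theorem theorem1 (R : realFieldType) (V : finType) (w : {set V} -> R) (k : nat) :
  (2 <= #|V|)%N ->
  (forall e : {set V}, is_edge e -> 0 < w e) ->
  {in [pred e : {set V} | is_edge e] &, injective w} ->
  (1 <= k <= #|V| - 1)%N ->
  (#|Mk w k| <= #|V| * k - 'C(k.+1, 2))%N.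
Proof.
move=> _ _ w_inj /andP[k0 kV].
pose t (x : V) : R := (enum_rank x)%:R.
have t_inj : injective t.
  by move=> x y /eqP; rewrite eqr_nat => /eqP/val_inj/enum_rank_inj.
have sepM e := @Mk_separating_motion R V w k t e t_inj k0.
(* The additive form avoids truncated subtraction. *)
suff /(leq_sub2r 'C(k.+1, 2)) : (#|Mk w k| + 'C(k.+1, 2) <= #|V| * k)%N.
  by rewrite addnK.
apply: (separating_motion_card t_inj _ _ sepM).
  exact: leq_trans kV (leq_subr _ _).
(* A separating motion exhibits the two endpoints of its edge, so elements of [Mk] are edges and [w]
   is injective on them. *)
move=> e f /sepM[m [_ _ [u [v [uv -> _]]]]] /sepM[m' [_ _ [u' [v' [uv' -> _]]]]].
by apply: w_inj; rewrite inE /is_edge cards2 ?uv ?uv'.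
Qed.
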